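(* Let $X$ be a finitely generated biquandle and let $Y$ be a medial biquandle. Then the Hom-biquandle $\mathbf{Hom}_B(X,Y)$ is isomorphic to a subbiquandle of $Y^{k}$, where $k$ is the size of a minimal generating set for $X$.
   Context: A biquandle is a set $X$ with two binary operations $\underline{\ast},\overline{\ast}$ such that: (i) $x\,\underline{\ast}\,x=x\,\overline{\ast}\,x$ for all $x$; (ii) for every $y$ the maps $x\mapsto x\,\underline{\ast}\,y$ and $x\mapsto x\,\overline{\ast}\,y$ are bijections of $X$, and $S(x,y)=(y\,\overline{\ast}\,x,\;x\,\underline{\ast}\,y)$ is a bijection of $X\times X$; (iii) for all $x,y,z$: $(x\underline{\ast}y)\underline{\ast}(z\underline{\ast}y)=(x\underline{\ast}z)\underline{\ast}(y\overline{\ast}z)$, $(x\underline{\ast}y)\overline{\ast}(z\underline{\ast}y)=(x\overline{\ast}z)\underline{\ast}(y\overline{\ast}z)$, $(x\overline{\ast}y)\overline{\ast}(z\overline{\ast}y)=(x\overline{\ast}z)\overline{\ast}(y\underline{\ast}z)$. A biquandle homomorphism is a map preserving both operations; $\mathrm{Hom}_B(X,Y)$ is the set of biquandle homomorphisms $X\to Y$. A subbiquandle is a subset that is a biquandle under the restricted operations; a subset generates $X$ if the smallest subbiquandle containing it is $X$. $Y^k$ is the $k$-fold product with componentwise operations. A biquandle is medial if $(x\underline{\ast}y)\underline{\ast}(z\underline{\ast}w)=(x\underline{\ast}z)\underline{\ast}(y\underline{\ast}w)$, $(x\underline{\ast}y)\overline{\ast}(z\underline{\ast}w)=(x\overline{\ast}z)\underline{\ast}(y\overline{\ast}w)$,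 $(x\overline{\ast}y)\overline{\ast}(z\overline{\ast}w)=(x\overline{\ast}z)\overline{\ast}(y\overline{\ast}w)$ for all $x,y,z,w$. If $Y$ is medial, $\mathrm{Hom}_B(X,Y)$ with pointwise operations $(f\underline{\ast}g)(x)=f(x)\underline{\ast}g(x)$, $(f\overline{\ast}g)(x)=f(x)\overline{\ast}g(x)$ is a medial biquandle (known), called the Hom-biquandle $\mathbf{Hom}_B(X,Y)$. *)

(* Defs.v *)
From mathcomp Require Import all_boot.
From mathcomp Require Import boolp classical_sets functions cardinality.

Set Implicit Arguments.
Unset Strict Implicit.
Unset Printing Implicit Defensive.

Local Open Scope classical_set_scope.

Declare Scope biquandle_scope.
Delimit Scope biquandle_scope with B.

Section BiquandleLaws.
Variables (T : Type) (u o : T -> T -> T).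
Local Notation "x *_ y" := (u x y) (at level 40, left associativity).
Local Notation "x *^ y" := (o x y) (at level 40, left associativity).

Record is_biquandle : Prop := IsBiquandle {
  bq_diag : forall x, x *_ x = x *^ x;
  bq_under_bij : forall y, bijective (fun x => x *_ y);
  bq_over_bij : forall y, bijective (fun x => x *^ y);
  bq_switch_bij : bijective (fun p : T * T => (p.2 *^ p.1, p.1 *_ p.2));
  bq_exch_uu : forall x y z,
    (x *_ y) *_ (z *_ y) = (x *_ z) *_ (y *^ z);
  bq_exch_uo : forall x y z,
    (x *_ y) *^ (z *_ y) = (x *^ z) *_ (y *^ z);
  bq_exch_oo : forall x y z,
    (x *^ y) *^ (z *^ y) = (x *^ z) *^ (y *_ z) }.

Record is_medial : Prop := IsMedial {
  med_uu : forall x y z w,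
    (x *_ y) *_ (z *_ w) = (x *_ z) *_ (y *_ w);
  med_uo : forall x y z w,
    (x *_ y) *^ (z *_ w) = (x *^ z) *_ (y *^ w);
  med_oo : forall x y z w,
    (x *^ y) *^ (z *^ w) = (x *^ z) *^ (y *^ w) }.

End BiquandleLaws.

Record biquandle := Biquandle {
  bq_sort :> Type;
  under : bq_sort -> bq_sort -> bq_sort;
  over : bq_sort -> bq_sort -> bq_sort;
  biquandleP : is_biquandle under over }.

Notation "x *_ y" := (under x y)
  (at level 40, left associativity) : biquandle_scope.
Notation "x *^ y" := (over x y)
  (at level 40, left associativity) : biquandle_scope.
Local Open Scope biquandle_scope.

Definition medial (Y : biquandle) : Prop := is_medial (@under Y) (@over Y).

Record bq_hom (X Y : biquandle) := BqHom {
  hom_fun :> X -> Y;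
  hom_under : forall x y, hom_fun (x *_ y) = hom_fun x *_ hom_fun y;
  hom_over : forall x y, hom_fun (x *^ y) = hom_fun x *^ hom_fun y }.

Definition isomorphic (X Y : biquandle) : Prop :=
  exists f : bq_hom X Y, bijective f.

Section Subbiquandle.
Variable X : biquandle.

Definition closed_op (op : X -> X -> X) (A : set X) : Prop :=
  forall x y, A x -> A y -> A (op x y).

Definition restrict_op (op : X -> X -> X) (A : set X) (cA : closed_op op A)
    (x y : {x : X | A x}) : {x : X | A x} :=
  exist A (op (sval x) (sval y)) (cA _ _ (svalP x) (svalP y)).

(* Closure under the two operations does not suffice when X is infinite: the
   restricted translations and switch map must also be bijections of A. *)
Record subbiquandle := Subbiquandle {
  sub_set :> set X;
  sub_under : closed_op (@under X) sub_set;
  sub_over : closed_op (@over X) sub_set;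
  sub_biquandleP : is_biquandle (restrict_op sub_under) (restrict_op sub_over) }.

Definition biquandle_of_sub (S : subbiquandle) : biquandle :=
  Biquandle (sub_biquandleP S).

Definition is_subbiquandle (A : set X) : Prop :=
  exists S : subbiquandle, sub_set S = A.

Definition generates (A : set X) : Prop :=
  smallest is_subbiquandle A = [set: X].

Definition finitely_generated : Prop :=
  exists A : set X, finite_set A /\ generates A.

(* Minimality is with respect to inclusion; a finite generating set of least
   cardinality is in particular minimal in this sense. *)
Definition minimal_generating (A : set X) : Prop :=
  generates A /\ forall B : set X, B `<=` A -> generates B -> B = A.

End Subbiquandle.

Section Power.
Variables (Y : biquandle) (k : nat).

Definition pow_under (f g : 'I_k -> Y) : 'I_k -> Y := fun i => f i *_ g i.
Definition pow_over (f g : 'I_k -> Y) : 'I_k -> Y := fun i => f i *^ g i.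

Lemma bij_inv (A B : Type) (f : A -> B) :
  bijective f -> {g : B -> A | cancel f g /\ cancel g f}.
Proof. by move=> bf; apply: cid; case: bf => g; exists g. Qed.

Lemma pow_is_biquandle : is_biquandle pow_under pow_over.
Proof.
have YP := biquandleP Y; split.
- by move=> f; apply: funext => i; apply: bq_diag.
- move=> g; pose h i := bij_inv (bq_under_bij YP (g i)).
  exists (fun f i => sval (h i) (f i)) => f; apply: funext => i;
    have [c1 c2] := svalP (h i); by [exact: c1|exact: c2].
- move=> g; pose h i := bij_inv (bq_over_bij YP (g i)).
  exists (fun f i => sval (h i) (f i)) => f; apply: funext => i;
    have [c1 c2] := svalP (h i); by [exact: c1|exact: c2].
- have [s c1 c2] := bq_switch_bij YP.
  exists (fun p => (fun i => (s (p.1 i, p.2 i)).1,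
                    fun i => (s (p.1 i, p.2 i)).2)) => -[f g] /=.
    by congr pair; apply: funext => i; rewrite (c1 (f i, g i)).
  by congr pair; apply: funext => i; case: (c2 (f i, g i)).
- by move=> f g h; apply: funext => i; apply: bq_exch_uu.
- by move=> f g h; apply: funext => i; apply: bq_exch_uo.
- by move=> f g h; apply: funext => i; apply: bq_exch_oo.
Qed.

Definition pow_biquandle : biquandle := Biquandle pow_is_biquandle.

End Power.

Section Hom.
Variables (X Y : biquandle) (mY : medial Y).

Lemma bq_hom_ext (f g : bq_hom X Y) : (forall x, f x = g x) -> f = g.
Proof.
case: f g => [f fu fo] [g gu go] /= /funext fg; rewrite fg in fu fo *.
by rewrite (Prop_irrelevance fu gu) (Prop_irrelevance fo go).
Qed.

Section Pointwise.
Variables f g : bq_hom X Y.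

Lemma hom_under_op_under x y :
  f (x *_ y) *_ g (x *_ y) = (f x *_ g x) *_ (f y *_ g y).
Proof. by rewrite !hom_under (med_uu mY). Qed.

Lemma hom_under_op_over x y :
  f (x *^ y) *_ g (x *^ y) = (f x *_ g x) *^ (f y *_ g y).
Proof. by rewrite !hom_over (med_uo mY). Qed.

Lemma hom_over_op_under x y :
  f (x *_ y) *^ g (x *_ y) = (f x *^ g x) *_ (f y *^ g y).
Proof. by rewrite !hom_under (med_uo mY). Qed.

Lemma hom_over_op_over x y :
  f (x *^ y) *^ g (x *^ y) = (f x *^ g x) *^ (f y *^ g y).
Proof. by rewrite !hom_over (med_oo mY). Qed.

Definition hom_under_op : bq_hom X Y :=
  @BqHom X Y (fun x => f x *_ g x) hom_under_op_under hom_under_op_over.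

Definition hom_over_op : bq_hom X Y :=
  @BqHom X Y (fun x => f x *^ g x) hom_over_op_under hom_over_op_over.

End Pointwise.

Lemma hom_under_bij (g : bq_hom X Y) : bijective (fun f => hom_under_op f g).
Proof.
have YP := biquandleP Y.
pose h y := bij_inv (bq_under_bij YP y).
have h1 y x : sval (h y) (x *_ y) = x by have [c _] := svalP (h y); exact: c.
have h2 y x : sval (h y) x *_ y = x by have [_ c] := svalP (h y); exact: c.
have i1 (f : bq_hom X Y) x y : sval (h (g (x *_ y))) (f (x *_ y)) =
    sval (h (g x)) (f x) *_ sval (h (g y)) (f y).
  apply: (bij_inj (bq_under_bij YP (g (x *_ y)))).
  by rewrite h2 !hom_under (med_uu mY) !h2.
have i2 (f : bq_hom X Y) x y : sval (h (g (x *^ y))) (f (x *^ y)) =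
    sval (h (g x)) (f x) *^ sval (h (g y)) (f y).
  apply: (bij_inj (bq_under_bij YP (g (x *^ y)))).
  by rewrite h2 !hom_over -(med_uo mY) !h2.
exists (fun f => BqHom (i1 f) (i2 f)) => f; apply: bq_hom_ext => x /=.
  exact: h1.
exact: h2.
Qed.

Lemma hom_over_bij (g : bq_hom X Y) : bijective (fun f => hom_over_op f g).
Proof.
have YP := biquandleP Y.
pose h y := bij_inv (bq_over_bij YP y).
have h1 y x : sval (h y) (x *^ y) = x by have [c _] := svalP (h y); exact: c.
have h2 y x : sval (h y) x *^ y = x by have [_ c] := svalP (h y); exact: c.
have i1 (f : bq_hom X Y) x y : sval (h (g (x *_ y))) (f (x *_ y)) =
    sval (h (g x)) (f x) *_ sval (h (g y)) (f y).
  apply: (bij_inj (bq_over_bij YP (g (x *_ y)))).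
  by rewrite h2 !hom_under (med_uo mY) !h2.
have i2 (f : bq_hom X Y) x y : sval (h (g (x *^ y))) (f (x *^ y)) =
    sval (h (g x)) (f x) *^ sval (h (g y)) (f y).
  apply: (bij_inj (bq_over_bij YP (g (x *^ y)))).
  by rewrite h2 !hom_over (med_oo mY) !h2.
exists (fun f => BqHom (i1 f) (i2 f)) => f; apply: bq_hom_ext => x /=.
  exact: h1.
exact: h2.
Qed.

Lemma hom_switch_bij :
  bijective (fun p => (hom_over_op p.2 p.1, hom_under_op p.1 p.2)).
Proof.
have [s c1 c2] := bq_switch_bij (biquandleP Y).
have d1 p : (s p).2 *^ (s p).1 = p.1 by rewrite -{3}(c2 p).
have d2 p : (s p).1 *_ (s p).2 = p.2 by rewrite -{3}(c2 p).
have su (a b c d : Y) : s (a *_ c, b *_ d) =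
    ((s (a, b)).1 *_ (s (c, d)).1, (s (a, b)).2 *_ (s (c, d)).2).
  apply: (can_inj c1); rewrite c2 /=.
  by rewrite (med_uo mY) (med_uu mY) !d1 !d2.
have so (a b c d : Y) : s (a *^ c, b *^ d) =
    ((s (a, b)).1 *^ (s (c, d)).1, (s (a, b)).2 *^ (s (c, d)).2).
  apply: (can_inj c1); rewrite c2 /=.
  by rewrite (med_oo mY) -(med_uo mY) !d1 !d2.
pose t1 (p : bq_hom X Y * bq_hom X Y) x := (s (p.1 x, p.2 x)).1.
pose t2 (p : bq_hom X Y * bq_hom X Y) x := (s (p.1 x, p.2 x)).2.
have t1u p x y : t1 p (x *_ y) = t1 p x *_ t1 p y.
  by rewrite /t1 !hom_under su.
have t1o p x y : t1 p (x *^ y) = t1 p x *^ t1 p y.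
  by rewrite /t1 !hom_over so.
have t2u p x y : t2 p (x *_ y) = t2 p x *_ t2 p y.
  by rewrite /t2 !hom_under su.
have t2o p x y : t2 p (x *^ y) = t2 p x *^ t2 p y.
  by rewrite /t2 !hom_over so.
exists (fun p => (BqHom (t1u p) (t1o p), BqHom (t2u p) (t2o p))) => -[f g] /=.
  congr pair; apply: bq_hom_ext => x; rewrite /= ?/t1 ?/t2 /=;
    by rewrite (c1 (f x, g x)).
congr pair; apply: bq_hom_ext => x; rewrite /= ?/t1 ?/t2 /=.
  by rewrite d1.
by rewrite d2.
Qed.

Lemma hom_is_biquandle : is_biquandle hom_under_op hom_over_op.
Proof.
have YP := biquandleP Y; split.
- by move=> f; apply: bq_hom_ext => x; apply: bq_diag.
- exact: hom_under_bij.
- exact: hom_over_bij.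
- exact: hom_switch_bij.
- by move=> f g h; apply: bq_hom_ext => x; apply: bq_exch_uu.
- by move=> f g h; apply: bq_hom_ext => x; apply: bq_exch_uo.
- by move=> f g h; apply: bq_hom_ext => x; apply: bq_exch_oo.
Qed.

Definition hom_biquandle : biquandle := Biquandle hom_is_biquandle.

Lemma hom_biquandle_medial : medial hom_biquandle.
Proof.
split=> f g h l; apply: bq_hom_ext => x.
- exact: (med_uu mY).
- exact: (med_uo mY).
- exact: (med_oo mY).
Qed.

End Hom.

(* Main.v *)
(* A homomorphism out of X is determined by its restriction to a generating set
   A, because the equalizer of two homomorphisms is a subbiquandle.  Since the
   operations of the Hom-biquandle are pointwise, evaluation at the k elements
   of A is an injective homomorphism into Y^k, and its image is a subbiquandle. *)
Require Import Defs.
From mathcomp Require Import all_boot.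
From mathcomp Require Import boolp classical_sets functions cardinality.

Set Implicit Arguments.
Unset Strict Implicit.
Unset Printing Implicit Defensive.

Local Open Scope classical_set_scope.
Local Open Scope card_scope.
Local Open Scope biquandle_scope.

(** [bijective] asks for an inverse function, which choice ([cid]) extracts from surjectivity. *)
Lemma inj_surj_bijective (S T : Type) (f : S -> T) :
  injective f -> (forall y, exists x, f x = y) -> bijective f.
Proof.
move=> injf surjf; exists (fun y => sval (cid (surjf y))).
  by move=> x; apply: injf; exact: svalP (cid (surjf (f x))).
by move=> y; exact: svalP (cid (surjf y)).
Qed.

Section ClosedSubset.
Variables (X : biquandle) (A : set X).
Hypotheses (cu : closed_op (@under X) A) (co : closed_op (@Defs.over X) A).
Hypothesis cancel_under : forall x y, A y -> A (x *_ y) -> A x.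
Hypothesis cancel_over : forall x y, A y -> A (x *^ y) -> A x.
Hypothesis cancel_switch :
  forall x y, A (y *^ x) -> A (x *_ y) -> A x /\ A y.

(** Identities and injectivity are inherited from [X]. Surjectivity is the real issue: the
    cancellation hypotheses put the preimages, found in [X], back into [A]. *)
Lemma restrict_is_biquandle :
  is_biquandle (restrict_op cu) (restrict_op co).
Proof.
have XP := biquandleP X.
have eqA (x y : {x : X | A x}) : sval x = sval y -> x = y.
  by case: x y => [a Aa] [b Ab]; exact: eq_exist.
split.
- by move=> x; apply: eqA; apply: bq_diag.
- move=> [y Ay]; apply: inj_surj_bijective => [a b /(congr1 sval) /= ab|[z Az]].
    by apply: eqA; exact: (bij_inj (bq_under_bij XP y)).
  have [g _ gK] := bq_under_bij XP y.
  have Ag : A (g z) by apply: (cancel_under Ay); rewrite gK.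
  by exists (exist _ (g z) Ag); apply: eqA; exact: gK.
- move=> [y Ay]; apply: inj_surj_bijective => [a b /(congr1 sval) /= ab|[z Az]].
    by apply: eqA; exact: (bij_inj (bq_over_bij XP y)).
  have [g _ gK] := bq_over_bij XP y.
  have Ag : A (g z) by apply: (cancel_over Ay); rewrite gK.
  by exists (exist _ (g z) Ag); apply: eqA; exact: gK.
- have [s sK Ks] := bq_switch_bij XP.
  apply: inj_surj_bijective => [[a b] [c d] /= [e1 e2]|[[a Aa] [b Ab]]].
    have [ac bd] : (sval a, sval b) = (sval c, sval d).
      by apply: (can_inj sK); rewrite /= e1 e2.
    by rewrite (eqA _ _ ac) (eqA _ _ bd).
  case E: (s (a, b)) => [x y].
  have [yx xy] : (y *^ x, x *_ y) = (a, b) by rewrite -(Ks (a, b)) E.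
  have [||Ax Ay] := @cancel_switch x y; rewrite ?yx ?xy //.
  by exists (exist _ x Ax, exist _ y Ay); congr pair; apply: eqA.
- by move=> x y z; apply: eqA; apply: bq_exch_uu.
- by move=> x y z; apply: eqA; apply: bq_exch_uo.
- by move=> x y z; apply: eqA; apply: bq_exch_oo.
Qed.

Definition closed_subbiquandle : subbiquandle X :=
  Subbiquandle restrict_is_biquandle.

End ClosedSubset.

(** The cancellation conditions hold because the translations and the switch map of [Y] are
    injective. *)
Lemma equalizer_is_subbiquandle (X Y : biquandle) (f g : bq_hom X Y) :
  is_subbiquandle [set x | f x = g x].
Proof.
have YP := biquandleP Y.
have cu : closed_op (@under X) [set x | f x = g x].
  by move=> x y /= fgx fgy; rewrite !hom_under fgx fgy.
have co : closed_op (@Defs.over X) [set x | f x = g x].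
  by move=> x y /= fgx fgy; rewrite !hom_over fgx fgy.
unshelve eexists (@closed_subbiquandle X _ cu co _ _ _) => //.
- move=> x y /= fgy; rewrite !hom_under fgy.
  exact: (bij_inj (bq_under_bij YP (g y))).
- move=> x y /= fgy; rewrite !hom_over fgy.
  exact: (bij_inj (bq_over_bij YP (g y))).
(* Together [e1] and [e2] say that the switch map of [Y] takes the same value at [(f x, f y)] and
   [(g x, g y)]. *)
- move=> x y /=; rewrite hom_over [g (y *^ x)]hom_over !hom_under => e1 e2.
  have [] // : (f x, f y) = (g x, g y).
  by apply: (bij_inj (bq_switch_bij YP)); rewrite /= e1 e2.
Qed.

Lemma eq_on_generates (X Y : biquandle) (A : set X) (f g : bq_hom X Y) :
  generates A -> (forall x, A x -> f x = g x) -> f = g.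
Proof.
move=> genA fgA; apply: bq_hom_ext => x.
have : smallest (@is_subbiquandle X) A x by rewrite genA.
(* [smallest] is an intersection, and the equalizer is one of the sets intersected. *)
move=> /(_ [set x | f x = g x]); apply.
by split; [exact: equalizer_is_subbiquandle | exact: fgA].
Qed.

(** For cancellation, solve the equation upstairs in [X]; by injectivity in [Y], the image of that
    solution is the given element. *)
Lemma range_is_subbiquandle (X Y : biquandle) (f : bq_hom X Y) :
  is_subbiquandle (range f).
Proof.
have XP := biquandleP X; have YP := biquandleP Y.
have cu : closed_op (@under Y) (range f).
  by move=> _ _ [a _ <-] [b _ <-]; exists (a *_ b); rewrite ?hom_under.
have co : closed_op (@Defs.over Y) (range f).
  by move=> _ _ [a _ <-] [b _ <-]; exists (a *^ b); rewrite ?hom_over.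
unshelve eexists (@closed_subbiquandle Y _ cu co _ _ _) => //.
- move=> x _ [b _ <-] [c _ fc]; have [g _ gK] := bq_under_bij XP b.
  exists (g c) => //; apply: (bij_inj (bq_under_bij YP (f b))).
  by rewrite -fc -hom_under gK.
- move=> x _ [b _ <-] [c _ fc]; have [g _ gK] := bq_over_bij XP b.
  exists (g c) => //; apply: (bij_inj (bq_over_bij YP (f b))).
  by rewrite -fc -hom_over gK.
- move=> x y [a _ fa] [b _ fb]; have [s _ Ks] := bq_switch_bij XP.
  case E: (s (a, b)) => [c d].
  have [dc cd] : (d *^ c, c *_ d) = (a, b) by rewrite -(Ks (a, b)) E.
  have [<- <-] : (f c, f d) = (x, y).
    apply: (bij_inj (bq_switch_bij YP)).
    by rewrite /= -hom_over -hom_under dc cd fa fb.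
  by split; [exists c | exists d].
Qed.

Lemma injective_hom_isomorphic (X Y : biquandle) (f : bq_hom X Y) :
  injective f -> exists S : subbiquandle Y, isomorphic X (biquandle_of_sub S).
Proof.
move=> injf; have [S eS] := range_is_subbiquandle f; exists S.
(* The carrier of [S] is only propositionally equal to [range f], so membership is transported along
   [eS]. *)
have fS x : sub_set S (f x) by rewrite eS; exists x.
unshelve eexists (@BqHom X (biquandle_of_sub S)
    (fun x => exist _ (f x) (fS x)) _ _).
- by move=> x y; apply: eq_exist; exact: hom_under.
- by move=> x y; apply: eq_exist; exact: hom_over.
apply: inj_surj_bijective => [x y /(congr1 sval) /injf //|[y Sy]].
have [x _ fx] : range f y by rewrite -eS.
by exists x; apply: eq_exist.
Qed.

Section Evaluation.
Variables (X Y : biquandle) (mY : medial Y) (k : nat) (e : 'I_k -> X).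

(** Operations on both sides are pointwise, so both homomorphism laws hold by conversion. *)
Definition eval_hom : bq_hom (hom_biquandle X mY) (pow_biquandle Y k) :=
  @BqHom (hom_biquandle X mY) (pow_biquandle Y k)
    (fun f i => (f : bq_hom X Y) (e i)) (fun _ _ => erefl) (fun _ _ => erefl).

Lemma eval_hom_inj (A : set X) :
  generates A -> A `<=` range e -> injective eval_hom.
Proof.
move=> genA Ae f g fg; apply: (eq_on_generates genA) => _ /Ae[i _ <-].
exact: (congr1 (fun h : 'I_k -> Y => h i) fg).
Qed.

End Evaluation.

(** The enumeration [e] is the inverse of a bijection from [A] onto the naturals below [k]. *)
Lemma card_eq_range (T : Type) (A : set T) (k : nat) :
  A #= `I_k -> exists e : 'I_k -> T, A `<=` range e.
Proof.
move=> /card_bijP[f [g fK _]].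
have ltk (i : 'I_k) : `I_k (i : nat) by exact: ltn_ord.
exists (fun i => set_val (g (SigSub (mem_set (ltk i))))) => x Ax.
pose a : A := SigSub (mem_set Ax).
have fak : set_val (f a) < k := set_valP (f a).
(* The index of [x] is its image under [f]; [val_inj] disregards the membership proof, and [fK] then
   returns [x]. *)
exists (Ordinal fak) => //=.
by rewrite (_ : SigSub _ = f a) ?fK //; exact: val_inj.
Qed.

Theorem proposition5p10 (X Y : biquandle) (finX : finitely_generated X)
    (medY : medial Y) (k : nat) (A : set X)
    (minA : minimal_generating A) (cardA : A #= `I_k) :
  exists S : subbiquandle (pow_biquandle Y k),
    isomorphic (hom_biquandle X medY) (biquandle_of_sub S).
Proof.
have [e Ae] := card_eq_range cardA.
have [genA _] := minA.
exact: injective_hom_isomorphic (eval_hom_inj (mY := medY) genA Ae).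
Qed.
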